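(* For every integer $k\ge2$, the graph $\mathcal{H}_{k,k+1}$ is DS (determined by its spectrum).
   Context: Graphs are finite, simple and undirected; the spectrum of a graph is the multiset of eigenvalues of its adjacency matrix. A graph $G$ is DS if every graph with the same spectrum as $G$ is isomorphic to $G$. $\mathcal{L}_{k,k}$ is the complete bipartite graph $K_{k,k}$ minus a perfect matching; $\mathcal{H}_{k,k+1}$ is obtained from $\mathcal{L}_{k,k}$ by adding a new vertex and joining it to all vertices of one part. *)

(* Defs.v *)
From mathcomp Require Import all_boot all_order all_algebra all_field.

Set Implicit Arguments.
Unset Strict Implicit.
Unset Printing Implicit Defensive.

Import GRing.Theory.
Local Open Scope ring_scope.

Record sgraph := SGraph {
  vertex :> finType;
  adj : rel vertex;
  adj_sym : symmetric adj;
  adj_irrefl : irreflexive adj }.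

Definition adjmx (G : sgraph) : 'M[algC]_#|G| :=
  \matrix_(i, j) (adj (enum_val i) (enum_val j))%:R.

(* The eigenvalues with multiplicity: the roots of the characteristic
   polynomial in algC, listed in an unspecified order.  The list represents a
   multiset, so spectra are compared with perm_eq. *)
Definition spectrum (G : sgraph) : seq algC :=
  sval (closed_field_poly_normal (char_poly (adjmx G))).

Lemma spectrumP (G : sgraph) :
  char_poly (adjmx G) = \prod_(x <- spectrum G) ('X - x%:P).
Proof.
rewrite /spectrum; case: closed_field_poly_normal => s /= {1}->.
by rewrite (monicP (char_poly_monic _)) scale1r.
Qed.

Definition isomorphic (G H : sgraph) : Prop :=
  exists2 f : G -> H, bijective f & forall x y, adj (f x) (f y) = adj x y.

Definition DS (G : sgraph) : Prop :=
  forall H : sgraph, perm_eq (spectrum H) (spectrum G) -> isomorphic H G.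

(* The parts of K_{k,k} are the inl i and the inr i; the removed perfect
   matching consists of the edges {inl i, inr i}. *)
Definition L_adj (k : nat) : rel ('I_k + 'I_k) := fun u v =>
  match u, v with
  | inl i, inr j | inr i, inl j => i != j
  | _, _ => false
  end.

Lemma L_adj_sym k : symmetric (@L_adj k).
Proof. by case=> i [] j //=; rewrite eq_sym. Qed.

Lemma L_adj_irrefl k : irreflexive (@L_adj k).
Proof. by case. Qed.

Definition L_graph (k : nat) : sgraph := SGraph (@L_adj_sym k) (@L_adj_irrefl k).

Section AddVertex.
Variables (G : sgraph) (S : {set G}).

(* The new vertex None is joined exactly to the vertices in S. *)
Definition addv_adj : rel (option G) := fun u v =>
  match u, v with
  | Some x, Some y => adj x y
  | None, Some x | Some x, None => x \in S
  | None, None => false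
  end.

Lemma addv_adj_sym : symmetric addv_adj.
Proof. by case=> [x|] [y|] //=; rewrite adj_sym. Qed.

Lemma addv_adj_irrefl : irreflexive addv_adj.
Proof. by case=> [x|] //=; rewrite adj_irrefl. Qed.

Definition add_vertex : sgraph := SGraph addv_adj_sym addv_adj_irrefl.
End AddVertex.

Definition H_graph (k : nat) : sgraph :=
  @add_vertex (L_graph k) [set inl i | i : 'I_k].

(* Main.v *)
(* H_{k,k+1} is K_{k,k+1} minus a matching of size k; let B be its k x (k+1)
   biadjacency matrix, so that B B^T = I + (k-1)J.  Adjacency matrices being
   real symmetric, a cospectral graph G has an adjacency matrix A similar to
   that of H_{k,k+1}.  Similarity gives tr A^e = 0 for odd e, so G has no odd
   closed walk and is bipartite; rank A = 2k forces parts of sizes k and k+1,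
   and rank A(A^2 - I) <= 2 forces C C^T - I to have rank at most 1, where C is
   the biadjacency matrix of G seen from the k-part.  The 2 x 2 minors of
   C C^T - I read codeg(x,y)^2 = (d_x - 1)(d_y - 1), with all d_x <= k + 1 and,
   from tr A^2, sum of the d_x equal to k^2.  A vertex with d_x = k + 1 would
   force d_y = 2 for all others and k = 4, contradicting the sum; so every d_x
   is k and every codegree is k - 1, i.e. the non-edges between the parts form
   a matching of size k. *)
Require Import Defs.
From mathcomp Require Import all_boot all_order all_fingroup all_algebra all_field.
From mathcomp Require Import zify ring.

Set Implicit Arguments.
Unset Strict Implicit.
Unset Printing Implicit Defensive.

Import Order.TTheory GRing.Theory Num.Theory.
Local Open Scope ring_scope.

(** * Similarity of matrices and diagonalisation of real symmetric ones *)

(** The sizes may differ: cospectral graphs have equal orders only up to a proof, and rectangular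
    [P], [Q] avoid casts. *)
Definition mxsim (F : fieldType) (m n : nat) (A : 'M[F]_m) (B : 'M[F]_n) :=
  exists P : 'M[F]_(m, n), exists Q : 'M[F]_(n, m),
    [/\ P *m Q = 1%:M, Q *m P = 1%:M & A = P *m B *m Q].

Section Similarity.
Variable F : fieldType.

Lemma mxsim_trans m n p (A : 'M[F]_m) (B : 'M[F]_n) (C : 'M[F]_p) :
  mxsim A B -> mxsim B C -> mxsim A C.
Proof.
move=> [P [Q [PQ QP ->]]] [P' [Q' [PQ' QP' ->]]].
exists (P *m P'), (Q' *m Q); split; last by rewrite !mulmxA.
  by rewrite mulmxA -(mulmxA P) PQ' mulmx1.
by rewrite mulmxA -(mulmxA Q') QP mulmx1.
Qed.

Lemma mxsim_sym m n (A : 'M[F]_m) (B : 'M[F]_n) : mxsim A B -> mxsim B A.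
Proof.
move=> [P [Q [PQ QP ->]]]; exists Q, P; split=> //.
by rewrite !mulmxA QP mul1mx -mulmxA QP mulmx1.
Qed.

Lemma mxsimM m n (P : 'M[F]_(m, n)) (Q : 'M[F]_(n, m)) (A B : 'M[F]_n) :
  Q *m P = 1%:M -> (P *m A *m Q) * (P *m B *m Q) = P *m (A * B) *m Q.
Proof. by move=> QP; rewrite -!mulmxE !mulmxA -(mulmxA _ Q) QP mulmx1. Qed.

Lemma mxsimX m n (P : 'M[F]_(m, n)) (Q : 'M[F]_(n, m)) (A : 'M[F]_n) e :
  P *m Q = 1%:M -> Q *m P = 1%:M ->
  (P *m A *m Q) ^+ e = P *m (A ^+ e) *m Q.
Proof.
move=> PQ QP; elim: e => [|e IH]; first by rewrite !expr0 mulmx1 PQ.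
by rewrite !exprS IH mxsimM.
Qed.

Lemma mxsim_trace m n (A : 'M[F]_m) (B : 'M[F]_n) e :
  mxsim A B -> \tr (A ^+ e) = \tr (B ^+ e).
Proof.
move=> [P [Q [PQ QP ->]]].
by rewrite mxsimX // mxtrace_mulC mulmxA QP mul1mx.
Qed.

Lemma mxsim_rank m n (A : 'M[F]_m) (B : 'M[F]_n) :
  mxsim A B -> \rank A = \rank B.
Proof.
suff le p q (A' : 'M[F]_p) (B' : 'M[F]_q) : mxsim A' B' -> (\rank A' <= \rank B')%N.
  by move=> s; apply/eqP; rewrite eqn_leq !le //; apply: mxsim_sym.
move=> [P [Q [_ _ ->]]].
exact: leq_trans (mxrankM_maxl _ _) (mxrankM_maxr _ _).
Qed.

Lemma mxsim_cubic m n (A : 'M[F]_m) (B : 'M[F]_n) :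
  mxsim A B -> mxsim (A * (A * A - 1)) (B * (B * B - 1)).
Proof.
move=> [P [Q [PQ QP ->]]]; exists P, Q; split=> //.
have -> : (1 : 'M[F]_m) = P *m 1%:M *m Q by rewrite mulmx1 PQ.
by rewrite mxsimM // -mulmxBl -mulmxBr mxsimM.
Qed.

Lemma mxsim_diag_perm n (d d' : 'rV[F]_n) :
  perm_eq [seq d 0 i | i <- enum 'I_n] [seq d' 0 i | i <- enum 'I_n] ->
  mxsim (diag_mx d) (diag_mx d').
Proof.
move=> pe.
have /tuple_permP[s es] :
  perm_eq [tuple d 0 i | i < n] [tuple d' 0 i | i < n] by [].
have ds i : d 0 i = d' 0 (s i).
  have /(congr1 (fun t : n.-tuple F => tnth t i)) := val_inj es.
  by rewrite !tnth_mktuple.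
exists (perm_mx s), (perm_mx s^-1); split.
- by rewrite -perm_mxM mulgV perm_mx1.
- by rewrite -perm_mxM mulVg perm_mx1.
rewrite -row_permE -col_permE; apply/matrixP=> i j; rewrite !mxE ds.
by rewrite (inj_eq perm_inj).
Qed.

Lemma mxsim_char_poly n (A B : 'M[F]_n) :
  mxsim A B -> char_poly A = char_poly B.
Proof.
move=> [P [Q [PQ QP ->]]].
pose P' := map_mx polyC P; pose Q' := map_mx polyC Q.
have PQ' : P' *m Q' = 1%:M by rewrite -map_mxM PQ map_mx1.
have e : char_poly_mx (P *m B *m Q) = P' *m char_poly_mx B *m Q'.
  rewrite /char_poly_mx mulmxBr mulmxBl !map_mxM; congr (_ - _).
  by rewrite mul_mx_scalar -scalemxAl PQ' scalemx1.
rewrite /char_poly e !det_mulmx mulrAC -det_mulmx PQ' det1.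
by rewrite mul1r.
Qed.
End Similarity.

(** By the spectral theorem both matrices are similar to diagonal ones, and the characteristic
    polynomial fixes the diagonal up to order. *)
Lemma symmetric_char_poly_sim (m n : nat) (A : 'M[algC]_m) (B : 'M[algC]_n) :
  A^T = A -> B^T = B -> A \is a mxOver Num.real -> B \is a mxOver Num.real ->
  char_poly A = char_poly B -> mxsim A B.
Proof.
move=> As Bs Ar Br pAB.
have emn : m = n.
  by apply: succn_inj; rewrite -(size_char_poly A) -(size_char_poly B) pAB.
subst n.
have diagonalize (C : 'M[algC]_m) : C^T = C -> C \is a mxOver Num.real ->
    exists d : 'rV_m, mxsim C (diag_mx d).
  move=> Cs Cr; have : C \is normalmx.
    apply: symmetric_normalmx => //.
    by apply/is_hermitianmxP; rewrite expr0 scale1r map_mx_id.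
  move/orthomx_spectralP => eC; exists (spectral_diag C).
  exists (invmx (spectralmx C)), (spectralmx C); split=> //.
    by rewrite mulVmx // spectral_unit.
  by rewrite mulmxV // spectral_unit.
have [dA sA] := diagonalize A As Ar; have [dB sB] := diagonalize B Bs Br.
apply: (mxsim_trans sA); apply: mxsim_trans (mxsim_sym sB).
apply: mxsim_diag_perm; apply: prod_XsubC_eq.
have cp (d : 'rV[algC]_m) :
    \prod_(x <- [seq d 0 i | i <- enum 'I_m]) ('X - x%:P) = char_poly (diag_mx d).
  rewrite char_poly_trig ?diag_mx_is_trig // big_map big_enum.
  by apply: eq_bigr => i _; rewrite mxE eqxx.
by rewrite !cp -(mxsim_char_poly sA) -(mxsim_char_poly sB).
Qed.

(** * Block structure of matrices exchanging two parts *)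

Section OddMatrices.
Variables (F : fieldType) (n : nat) (D : 'M[F]_n).
Hypotheses (DD : D * D = D) (Dsym : D^T = D).

(* For D the projection onto one part of a bipartition, C is odd when it is
   symmetric and exchanges the two parts. *)
Definition odd_mx (C : 'M[F]_n) := C^T = C /\ D * C = C * (1 - D).

Lemma odd_mxC C : odd_mx C -> C * D = (1 - D) * C.
Proof.
by case=> _; rewrite mulrBr mulr1 mulrBl mul1r => ->; rewrite opprB addrC subrK.
Qed.

(** The two off-diagonal blocks [D * C] and [(1 - D) * C] are transposes of each other, and their
    row spaces meet only in 0. *)
Lemma odd_mx_rank C : odd_mx C -> \rank C = (\rank (D * C)%R).*2.
Proof.
move=> oC; have [Cs DC] := oC; have CD := odd_mxC oC.
have er : \rank ((1 - D) * C)%R = \rank (D * C)%R.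
  by rewrite -CD -mxrank_tr -mulmxE trmx_mul Cs Dsym.
have eC : C = D * C + (1 - D) * C by rewrite -mulrDl addrC subrK mul1r.
apply/eqP; rewrite eqn_leq -addnn -{2 4}er; apply/andP; split.
  by rewrite {1}eC mxrank_add.
rewrite -mxrank_disjoint_sum.
  by apply: mxrankS; rewrite addsmx_sub -!mulmxE !submxMl.
apply/eqP; rewrite -submx0; apply/rV_subP => v.
rewrite sub_capmx DC -CD => /andP[/submxP[x ex] /submxP[y ey]].
have vD : v *m D = v by rewrite {1}ey -mulmxA !mulmxE -mulrA DD -!mulmxE ey.
(* As a combination of rows of [C * (1 - D)], the vector [v] is killed by [D], which also fixes
   it. *)
suff -> : v = 0 by exact: sub0mx.
rewrite -vD ex -mulmxA -mulmxE !mulmxE.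
by rewrite -mulrA mulrBl mul1r DD subrr mulr0 mulmx0.
Qed.

Lemma odd_mx_square A : odd_mx A -> D * (A * A) = A * A * D.
Proof.
move=> oA; have [As DA] := oA; have AD := odd_mxC oA.
by rewrite mulrA DA -mulrA -AD mulrA.
Qed.

Lemma odd_mx_cubic A : odd_mx A -> odd_mx (A * (A * A - 1)).
Proof.
move=> oA; have [As DA] := oA; have AD := odd_mxC oA.
split.
  rewrite -!mulmxE trmx_mul linearB /= trmx_mul trmx1 As mulmxBl mulmxBr.
  by rewrite mulmxA mulmx1 mul1mx.
rewrite mulrA DA -!mulrA; congr (_ * _).
rewrite !mulrBl !mulrBr !mul1r !mulr1 (odd_mx_square oA) !opprB !addrA.
by rewrite addrAC [RHS]addrAC; congr (_ + _); rewrite addrAC.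
Qed.

(** Halving the rank of the odd matrix [A * (A * A - 1)] leaves rank at most 1 for
    [D * (A * A - 1) * A]. The factor [A] loses no rank: it is injective on the row space of [D],
    which contains that of [D * (A * A - 1)] because [D] commutes with [A * A]. *)
Lemma odd_mx_rank_square A : odd_mx A -> \rank (D * A)%R = \rank D ->
  (\rank (A * (A * A - 1))%R <= 2)%N -> (\rank (D * (A * A - 1))%R <= 1)%N.
Proof.
move=> oA rDA; rewrite (odd_mx_rank (odd_mx_cubic oA)) -[2%N]/(1.*2) leq_double.
have -> : D * (A * (A * A - 1)) = D * (A * A - 1) *m A.
  by rewrite mulmxE !mulrBr !mulrBl !mulr1 !mulrA.
suff /mxrank_injP -> : ((D * (A * A - 1))%R :&: kermx A)%MS == 0 by [].
have D0 : (D :&: kermx A)%MS == 0 by apply/mxrank_injP.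
rewrite -submx0 -(eqP D0); apply: capmxS => //.
by rewrite mulrBr mulr1 (odd_mx_square oA) addmx_sub ?eqmx_opp // -mulmxE submxMl.
Qed.

Lemma odd_mx_trace_square A : odd_mx A -> \tr (A * A) = \tr (D * (A * A)) *+ 2.
Proof.
move=> oA; have [As DA] := oA.
suff e : \tr (D * (A * A)) = \tr (A * A) - \tr (D * (A * A)).
  by rewrite mulr2n {1}e subrK.
rewrite {1}mulrA DA -!mulmxE -mulmxA mxtrace_mulC -mulmxA mulmxE.
by rewrite mulrBl mul1r raddfB.
Qed.

Lemma odd_mx_trace0 C : D * C = C * (1 - D) -> \tr C = 0.
Proof.
move=> DC.
have t0 : \tr (D * C) = 0.
  rewrite -DD -mulrA DC mulrA -[LHS]mxtrace_mulC mulmxE mulrA.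
  by rewrite mulrBl mul1r DD subrr mul0r mxtrace0.
have : \tr (D * C) = \tr C - \tr (D * C).
  by rewrite {1}DC mulrBr mulr1 raddfB /= -!mulmxE (mxtrace_mulC C).
by rewrite t0 subr0.
Qed.

Lemma odd_mxX A e : odd_mx A -> odd e -> D * A ^+ e = A ^+ e * (1 - D).
Proof.
move=> oA oe; have [_ DA] := oA.
rewrite -[e]odd_double_half oe exprD -mul2n exprM expr2 expr1.
have cD : GRing.comm D (A * A) by exact: odd_mx_square.
have -> : A * (A * A) ^+ e./2 * (1 - D) = A * ((1 - D) * (A * A) ^+ e./2).
  rewrite -mulrA; congr (_ * _).
  by apply/commr_sym/commrX/commr_sym/commrB; [exact: commr1 | exact: commr_sym].
by rewrite mulrA DA -!mulrA.
Qed.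

End OddMatrices.

(** * Rank-one minors and traces of idempotents *)

Lemma mxrank1_minor (F : fieldType) m n (M : 'M[F]_(m, n)) i j k l :
  (\rank M <= 1)%N -> M i j * M k l = M i l * M k j.
Proof.
rewrite -{2 3 4 5}(mulmx_base M).
move: (\rank M) (col_base M) (row_base M) => [|[|//]] C R _; rewrite !mxE.
  by rewrite !big_ord0 !mul0r.
by rewrite !big_ord1 mulrACA (mulrC (R _ j)) -mulrACA.
Qed.

(** In a rank factorisation [D = C *m R], idempotence forces [R *m C = 1%:M], whose trace is the
    rank. *)
Lemma mxtrace_idempotent (F : fieldType) n (D : 'M[F]_n) :
  D * D = D -> \tr D = (\rank D)%:R.
Proof.
move=> DD.
move: (mulmx_base D) (row_fullP (col_base_full D)) (row_freeP (row_base_free D)).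
move: (\rank D) (col_base D) (row_base D) => r C R CR [B BC] [B' RB].
have RC : R *m C = 1%:M.
  transitivity (B *m (D * D) *m B').
    by rewrite -CR -mulmxE !mulmxA BC mul1mx -mulmxA RB mulmx1.
  by rewrite DD -CR mulmxA BC mul1mx RB.
by rewrite -CR mxtrace_mulC RC mxtrace1.
Qed.

(** * Adjacency matrices, walks and bipartiteness *)

Section Graph.
Variable G : sgraph.
Local Notation A := (adjmx G).

Lemma adjmxE x y : A (enum_rank x) (enum_rank y) = (adj x y)%:R.
Proof. by rewrite mxE !enum_rankK. Qed.

Lemma tr_adjmx : A^T = A.
Proof. by apply/matrixP=> i j; rewrite !mxE adj_sym. Qed.

Lemma adjmx_real : A \is a mxOver Num.real.
Proof. by apply/mxOverP=> i j; rewrite mxE realn. Qed.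

Lemma sum_enum_val (R : nmodType) (f : G -> R) (P : pred G):
  \sum_(i < #|G| | P (enum_val i)) f (enum_val i) = \sum_(x | P x) f x.
Proof. by rewrite (reindex _ (onW_bij _ (@enum_val_bij G))). Qed.

Definition proj_mx_of (c : pred G) : 'M[algC]_#|G| :=
  diag_mx (\row_i (c (enum_val i))%:R).

Lemma proj_mxE c i j : proj_mx_of c i j = ((i == j) && c (enum_val i))%:R.
Proof. by rewrite !mxE; case: eqP => [->|_]; rewrite ?mulr0n ?mulr1n. Qed.

Lemma proj_mx_mulE c (M : 'M_#|G|) i j :
  (proj_mx_of c * M) i j = (c (enum_val i))%:R * M i j.
Proof. by rewrite -mulmxE mul_diag_mx !mxE. Qed.

Lemma mul_proj_mxE c (M : 'M_#|G|) i j :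
  (M * proj_mx_of c) i j = M i j * (c (enum_val j))%:R.
Proof. by rewrite -mulmxE mul_mx_diag !mxE. Qed.

Lemma proj_mx_idem c : proj_mx_of c * proj_mx_of c = proj_mx_of c.
Proof.
apply/matrixP=> i j; rewrite proj_mx_mulE proj_mxE -natrM mulnb andbC.
by rewrite -andbA andbb.
Qed.

Lemma tr_proj_mx c : (proj_mx_of c)^T = proj_mx_of c.
Proof. by rewrite tr_diag_mx. Qed.

Lemma proj_mxC c : proj_mx_of (predC c) = 1 - proj_mx_of c.
Proof.
apply/matrixP=> i j; rewrite proj_mxE !mxE /=.
by case: eqP => [->|_]; case: (c _); rewrite ?subr0 ?subrr ?mulr0n ?mulr1n ?subrr ?subr0.
Qed.

Lemma rank_proj_mx c : \rank (proj_mx_of c) = #|c|.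
Proof.
apply/eqP; rewrite -(eqr_nat algC) -mxtrace_idempotent ?proj_mx_idem //.
rewrite mxtrace_diag; apply/eqP.
under eq_bigr do rewrite mxE.
rewrite (@sum_enum_val _ (fun x => (c x)%:R) predT) -natr_sum.
by rewrite -sum1_card [in RHS]big_mkcond.
Qed.

Definition proper2 (c : pred G) := forall x y, adj x y -> c x != c y.

Lemma proper2_odd_mx c : proper2 c -> odd_mx (proj_mx_of c) A.
Proof.
move=> pc; split; first exact: tr_adjmx.
apply/matrixP=> i j; rewrite -proj_mxC proj_mx_mulE mul_proj_mxE mxE.
have := pc (enum_val i) (enum_val j); case: adj; last by rewrite mul0r mulr0.
by move=> /(_ isT) /=; do 2!case: (c _); rewrite ?mulr0 ?mul0r ?mulr1 ?mul1r.
Qed.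

Definition nbrs (x : G) := [set z | adj x z].

Lemma adjmx_squareE i j :
  (A * A) i j = #|nbrs (enum_val i) :&: nbrs (enum_val j)|%:R.
Proof.
rewrite -mulmxE !mxE; under eq_bigr do rewrite !mxE -natrM mulnb.
rewrite (@sum_enum_val _
  (fun z => (adj (enum_val i) z && adj z (enum_val j))%:R) predT) -natr_sum.
congr _%:R; rewrite -sum1_card [in RHS]big_mkcond; apply: eq_bigr => z _ /=.
by rewrite !inE (adj_sym z).
Qed.

Lemma adjmxX_ge0 e i j : 0 <= (A ^+ e) i j.
Proof.
elim: e i j => [|e IH] i j; first by rewrite expr0 mxE ler0n.
rewrite exprS -mulmxE mxE sumr_ge0 // => l _.
by rewrite mulr_ge0 // mxE ler0n.
Qed.

(* The bipartite double cover: its paths record the parity of walks in G. *)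
Definition dcover : rel (G * bool) := fun u v => adj u.1 v.1 && (u.2 != v.2).

(** A positive entry of a power of [A] stands for a walk of that length in [G]; each step changes
    sheet. *)
Lemma dcover_walk u p : path dcover u p ->
  (last u p).2 = u.2 (+) odd (size p) /\
  0 < (A ^+ size p) (enum_rank u.1) (enum_rank (last u p).1).
Proof.
elim: p u => [|v p IH] u /=; first by rewrite addbF expr0 mxE eqxx ltr01.
move=> /andP[/andP[uv nuv] /IH[-> pos]]; split.
  by move: nuv; do 2!case: _.2; case: odd.
rewrite exprS -mulmxE mxE (bigD1 (enum_rank v.1)) //= ltr_wpDr //.
  by rewrite sumr_ge0 // => i _; rewrite mulr_ge0 ?adjmxX_ge0 // mxE ler0n.
by rewrite adjmxE uv mul1r.
Qed.

(** A vertex is coloured by whether an odd walk reaches it from the root of its component. *)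
Lemma odd_trace0_proper2 :
  (forall e, odd e -> \tr (A ^+ e) = 0) -> exists c, proper2 c.
Proof.
move=> tr0.
have noodd x b : ~~ connect dcover (x, b) (x, ~~ b).
  apply/negP => /connectP[p /dcover_walk[/= + pos] lp].
  rewrite -lp /= => ob; have op : odd (size p) by move: ob; clear; case: b; case: odd.
  (* The diagonal entries are nonnegative with zero sum, so each vanishes. *)
  have /psumr_eq0P := tr0 _ op; move=> /(_ (fun i _ => adjmxX_ge0 _ _ _)).
  move=> /(_ (enum_rank x) isT) e0; move: pos.
  by rewrite -lp e0 ltxx.
have dsym : connect_sym dcover.
  by apply: sym_connect_sym => u v; rewrite /dcover adj_sym eq_sym.
have flip x b y b' :
    connect dcover (x, b) (y, b') -> connect dcover (x, ~~ b) (y, ~~ b').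
  move=> /connectP[p pp lp].
  pose f (u : G * bool) := (u.1, ~~ u.2).
  apply/connectP; exists (map f p); last by rewrite -[(x, _)]/(f (x, b)) last_map -lp.
  rewrite -[(x, _)]/(f (x, b)) (@homo_path _ _ _ dcover) // => u v.
  by rewrite /dcover /= (inj_eq negb_inj).
have lift x y : connect (@adj G) x y -> exists b, connect dcover (x, false) (y, b).
  move=> /connectP[p + ->]; elim/last_ind: p => [|p z IH] /=.
    by exists false; exact: connect0.
  rewrite rcons_path last_rcons => /andP[/IH[b cb] az]; exists (~~ b).
  by apply: connect_trans cb (connect1 _); rewrite /dcover /= az; case: b.
pose r := fingraph.root (@adj G).
exists (fun x => connect dcover (r x, false) (x, true)) => x y axy.
have csym := sym_connect_sym (@adj_sym G).
have rxy : r x = r y by apply/eqP; rewrite /r root_connect // connect1.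
have step b : dcover (x, b) (y, ~~ b) by rewrite /dcover /= axy; case: b.
have [cx|ncx] := boolP (connect dcover (r x, false) (x, true)).
  (* Odd walks from the root to both [x] and [y], joined by the edge, would close up to an odd walk
     at the root. *)
  rewrite eq_sym eqb_id -rxy; apply/negP => cy.
  have := noodd (r x) false; rewrite /= (connect_trans cy) //.
  rewrite dsym; apply: (connect_trans (flip _ _ _ _ cx)).
  exact/connect1/step.
rewrite eq_sym eqbF_neg negbK -rxy.
have [|b] := lift (r x) x; first by rewrite csym connect_root.
case: b => cx; first by rewrite cx in ncx.
exact: connect_trans cx (connect1 (step _)).
Qed.
End Graph.

(** * Ranks and traces for the graph [H_graph k] *)

Section HGraph.
Variable k : nat.
Hypothesis k_gt0 : (0 < k)%N.
Local Notation H := (H_graph k).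
Local Notation A := (adjmx H).

(** The part of size [k]; the added vertex [None] lies in the other one. *)
Definition inl_part : pred H := fun x => if x is Some (inl _) then true else false.
Local Notation D := (proj_mx_of inl_part).

Lemma H_adj_inr i (y : H) :
  adj (Some (inl i) : H) y = ~~ inl_part y && (y != Some (inr i)).
Proof.
case: y => [[j|j]|] //=.
by rewrite (inj_eq Some_inj) eq_sym (inj_eq inr_inj).
  by rewrite imset_f.
Qed.

Lemma card_H : #|H| = (k.*2).+1.
Proof. by rewrite card_option card_sum card_ord addnn. Qed.

Lemma card_inl_part : #|inl_part| = k.
Proof.
have inj : injective (fun i : 'I_k => Some (inl i) : H) by move=> i j [].
rewrite -[RHS](card_ord k) -(card_codom inj).
apply: eq_card => x; rewrite [LHS]unfold_in; apply/idP/codomP => [|[i ->//]].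
by case: x => [[i|]|] // _; exists i.
Qed.

Lemma inl_part_proper2 : proper2 inl_part.
Proof.
move=> [[i|i]|] [[j|j]|] //=.
  by move=> /imsetP[].
by move=> /imsetP[].
Qed.

(** One formula serves for degrees ([i = j]) and codegrees: the common neighbours are the other part
    minus the matching partners. *)
Lemma H_card_nbrs2 i j :
  #|nbrs (Some (inl i) : H) :&: nbrs (Some (inl j) : H)| = (k - (i != j))%N.
Proof.
have -> : nbrs (Some (inl i) : H) :&: nbrs (Some (inl j) : H) =
    ~: ([set x | inl_part x] :|: [set Some (inr i); Some (inr j)]).
  apply/setP=> x; rewrite !inE -!/(adj _ _) !H_adj_inr.
  by case: (inl_part x); case: (x == _).
rewrite cardsCs setCK card_H cardsU cards2 cardsE card_inl_part.
rewrite (inj_eq Some_inj) (inj_eq inr_inj).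
have -> : [set x | inl_part x] :&: [set Some (inr i); Some (inr j)] = set0.
  apply/setP=> x; rewrite !inE; case: eqP => [->//|_]; case: eqP => [->//|_].
  by rewrite andbF.
by rewrite cards0; case: (i != j); lia.
Qed.

Definition inl_row : 'rV[algC]_#|H| := \row_i (inl_part (enum_val i))%:R.

(** This is B B^T = I + (k-1)J written in full size, the outer product of [inl_row] being J. *)
Lemma proj_inl_square : D * (A * A) = D + (k.-1)%:R *: (inl_row^T *m inl_row).
Proof.
have oA := proper2_odd_mx inl_part_proper2.
have outerE (i j : 'I_#|H|) : (inl_row^T *m inl_row) i j =
    (inl_part (enum_val i))%:R * (inl_part (enum_val j))%:R.
  by rewrite mxE big_ord1 !mxE.
apply/matrixP=> i j; rewrite [in RHS]mxE proj_mxE [in RHS]mxE outerE.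
case ci: (inl_part (enum_val i)); last first.
  by rewrite proj_mx_mulE ci !mul0r andbF mulr0 addr0.
case cj: (inl_part (enum_val j)); last first.
  rewrite (odd_mx_square oA) mul_proj_mxE cj !mulr0 addr0.
  by case: eqP => // e; rewrite -e ci in cj.
rewrite proj_mx_mulE ci mul1r adjmx_squareE andbT mulr1 mulr1 -(inj_eq enum_val_inj).
case: (enum_val i) ci => [[a|]|] // _; case: (enum_val j) cj => [[b|]|] // _.
rewrite H_card_nbrs2 (inj_eq Some_inj) (inj_eq inl_inj) -natrD.
by congr _%:R; case: eqP; lia.
Qed.

Lemma inl_row_sqr : inl_row *m inl_row^T = k%:R%:M.
Proof.
apply/matrixP=> i j; rewrite !ord1 !mxE eqxx mulr1n.
under eq_bigr do rewrite !mxE -natrM mulnb andbb.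
rewrite (@sum_enum_val _ _ (fun x => (inl_part x)%:R) predT) -natr_sum.
congr _%:R; rewrite -[RHS]card_inl_part -sum1_card [in RHS]big_mkcond.
exact: eq_bigr.
Qed.

Lemma inl_rowD : inl_row *m D = inl_row.
Proof.
apply/matrixP=> i j; rewrite mul_mx_diag !mxE -natrM mulnb andbb //.
Qed.

Lemma H_rank_proj : \rank (D * A)%R = k.
Proof.
rewrite -[RHS]card_inl_part -rank_proj_mx.
apply/eqP; rewrite eqn_leq mxrankM_maxl /=.
(* Since J^2 = kJ, the inverse of I + aJ is I - cJ (Sherman-Morrison); this gives a right inverse of
   [D * A] relative to [D]. *)
pose a : algC := (k.-1)%:R; pose c := a / (1 + a * k%:R).
have nz : 1 + a * k%:R != 0 by rewrite addrC /a -natrM natr1 pnatr_eq0.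
suff {1}-> : D = D * A *m (A * (D - c *: (inl_row^T *m inl_row))).
  exact: mxrankM_maxl.
rewrite mulmxE mulrA -(mulrA D) proj_inl_square -/a -!mulmxE.
rewrite mulmxDl !mulmxBr -!scalemxAl -!scalemxAr -!mulmxA !inl_rowD.
rewrite (mulmxA inl_row) inl_row_sqr mul_scalar_mx -!scalemxAr !scalerA.
have -> : D *m (inl_row^T *m inl_row) = inl_row^T *m inl_row.
  by rewrite mulmxA -{1}tr_proj_mx -trmx_mul inl_rowD.
rewrite mulmxE proj_mx_idem -addrA addrC -[LHS]add0r; congr (_ + _).
rewrite -scaleNr -scalerBl -scalerDl.
suff -> : - c + (a - a * (c * k%:R)) = 0 by rewrite scale0r.
by rewrite /c; field.
Qed.

Lemma H_rank : \rank A = k.*2.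
Proof.
rewrite (odd_mx_rank _ _ (proper2_odd_mx inl_part_proper2)) ?H_rank_proj //.
- exact: proj_mx_idem.
- exact: tr_proj_mx.
Qed.

(** Here [D * (A * A - 1)] is (k-1)J, of rank at most 1, and oddness doubles the bound. *)
Lemma H_rank_cubic : (\rank (A * (A * A - 1))%R <= 2)%N.
Proof.
have oA := proper2_odd_mx inl_part_proper2.
rewrite (odd_mx_rank _ _ (odd_mx_cubic oA)) ?proj_mx_idem ?tr_proj_mx //.
rewrite -[2%N]/(1.*2) leq_double.
have -> : D * (A * (A * A - 1)) = D * (A * A - 1) * A.
  by rewrite !mulrBr !mulrBl !mulr1 !mulrA.
rewrite mulrBr mulr1 proj_inl_square addrC addKr -mulmxE -scalemxAl scalemxAr.
by rewrite -mulmxA (leq_trans (mxrankM_maxl _ _)) ?rank_leq_col.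
Qed.

Lemma H_trace_square : \tr (A * A) = (k ^ 2).*2%:R.
Proof.
rewrite (odd_mx_trace_square (proper2_odd_mx inl_part_proper2)).
rewrite proj_inl_square mxtraceD mxtraceZ mxtrace_mulC inl_row_sqr mxtrace_scalar.
rewrite (mxtrace_idempotent (proj_mx_idem _)) rank_proj_mx card_inl_part.
by rewrite mulr1n -natrM -natrD -mulrnA; congr _%:R; nia.
Qed.

Lemma H_odd_trace e : odd e -> \tr (A ^+ e) = 0.
Proof.
move=> oe; apply: (odd_mx_trace0 (proj_mx_idem inl_part)).
exact: odd_mxX (proper2_odd_mx inl_part_proper2) oe.
Qed.
End HGraph.

(** * Reconstruction of the graph from its degrees and codegrees *)

(** Each vertex of [c] misses exactly one vertex [m x] of the other part, and the codegrees make [m]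
    injective; the one vertex outside its image plays [None]. *)
Lemma isomorphic_H_graph (k : nat) (G : sgraph) (c : pred G) :
  #|G| = k.*2.+1 -> proper2 c -> #|c| = k ->
  (forall x, c x -> #|nbrs x| = k) ->
  (forall x y, c x -> c y -> x != y -> #|nbrs x :&: nbrs y| = k.-1) ->
  (0 < k)%N -> isomorphic G (H_graph k).
Proof.
move=> cardG pc cardc deg codeg k0.
pose W := [set z | ~~ c z].
have cardW : #|W| = k.+1.
  have := cardC c; rewrite cardc cardG cardsE => e.
  by apply/eqP; rewrite -(eqn_add2l k) e -addnn addnS.
have subW x : c x -> nbrs x \subset W.
  by move=> cx; apply/subsetP=> z; rewrite !inE => /pc; rewrite cx; case: (c z).
(* The implication sits under the existential so that [m] is total; outside [c] the value is a
   dummy. *)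
have missing x : exists z, c x -> W :\: nbrs x = [set z].
  have [cx|ncx] := boolP (c x); last by exists x.
  have /cards1P[z ez] : #|W :\: nbrs x| == 1%N.
    by rewrite cardsDS ?subW // cardW deg // subSnn.
  by exists z.
have [m mP] : exists m : G -> G, forall x, c x -> W :\: nbrs x = [set m x].
  by have [m mP] := fin_all_exists missing; exists m.
have mW x : c x -> ~~ c (m x).
  by move=> /mP e; have := set11 (m x); rewrite -e !inE => /andP[].
have adjE x z : c x -> adj x z = ~~ c z && (z != m x).
  move=> cx; have /setP/(_ z) := mP x cx; rewrite !inE => <-.
  have := pc x z; rewrite cx; case: (adj x z) => [/(_ isT)|_]; case: (c z) => //.
have m_inj : {in c &, injective m}.
  move=> x y cx cy exy; apply/eqP/negPn/negP => nxy.
  have := codeg x y cx cy nxy.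
  (* Missing the same vertex gives equal neighbourhoods, hence codegree [k] instead of [k.-1]. *)
  have -> : nbrs y = nbrs x.
    by apply/setP=> z; rewrite !inE !adjE // exy.
  by rewrite setIid deg // => ek; move: k0; rewrite {1}ek; case: (k) ek => // n /= /esym /n_Sn.
have [w0 w0W w0m] : exists2 w, ~~ c w & forall x, c x -> w != m x.
  have : (#|m @: c| < #|W|)%N by rewrite card_in_imset // cardc cardW.
  move=> lt; have /subsetPn[w wW wm] : ~~ (W \subset m @: c).
    by apply: contraL lt => /subset_leq_card; rewrite -leqNgt.
  exists w; first by rewrite inE in wW.
  by move=> x cx; apply: contraNneq wm => ->; rewrite imset_f.
pose u (i : 'I_k) : G := enum_val (cast_ord (esym cardc) i).
have cu i : c (u i) by have := enum_valP (cast_ord (esym cardc) i).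
have u_inj : injective u by move=> i j /enum_val_inj/cast_ord_inj.
pose g (v : H_graph k) : G :=
  match v with
  | Some (inl i) => u i
  | Some (inr i) => m (u i)
  | None => w0
  end.
have neqc x y : c x -> ~~ c y -> x <> y by move=> cx /negP ncy e; rewrite e in cx.
have mu_inj : injective (m \o u).
  by move=> i j /= /m_inj e; apply/u_inj/e; apply: cu.
have g_inj : injective g.
  case=> [[i|i]|] [[j|j]|] //=.
  - by move=> /u_inj ->.
  - by move/neqc => []; rewrite ?cu ?mW.
  - by move/neqc => []; rewrite ?cu.
  - by move/esym/neqc => []; rewrite ?cu ?mW.
  - by move=> /mu_inj ->.
  - by move/esym/eqP; rewrite (negPf (w0m _ _)).
  - by move/esym/neqc => []; rewrite ?cu.
  - by move/eqP; rewrite (negPf (w0m _ _)).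
have g_bij : bijective g.
  by apply: inj_card_bij => //; rewrite cardG card_H.
have adj0 x y : ~~ c x -> ~~ c y -> adj x y = false.
  by move=> /negPf cx /negPf cy; apply/negP => /pc; rewrite cx cy.
have g_adj x y : adj (g x) (g y) = adj x y.
  have adjl i y' : adj (g (Some (inl i))) (g y') = adj (Some (inl i) : H_graph k) y'.
    rewrite H_adj_inr [LHS](adjE _ _ (cu i)); case: y' => [[j|j]|] /=.
    - by rewrite cu.
    - rewrite mW //= (inj_eq mu_inj).
      by rewrite (inj_eq Some_inj) (inj_eq inr_inj).
    - by rewrite w0W w0m.
  case: x => [[i|i]|]; first exact: adjl.
    case: y => [[j|j]|]; first by rewrite adj_sym adjl adj_sym.
      by rewrite /= adj0 ?mW.
    rewrite /= adj0 ?mW //; apply/esym/negP => /imsetP[] //.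
  case: y => [[j|j]|]; first by rewrite adj_sym adjl adj_sym.
    rewrite /= adj0 ?mW //; apply/esym/negP => /imsetP[] //.
  by rewrite /= adj0.
have [f gK fK] := g_bij.
exists f; first by exists g.
by move=> x y; rewrite -g_adj !fK.
Qed.

(** * Arithmetic of degrees and codegrees *)

(** The equation reads (a-1)(b-1) = 1. *)
Lemma add_eq_mul a b : (a + b = a * b)%N -> (0 < a + b)%N -> a = 2%N /\ b = 2%N.
Proof.
case: a => [|[|a]]; case: b => [|[|b]] //; lia.
Qed.

(* d and e stand for the degrees and codegrees on the part c of size k. *)
Lemma degrees_of_minors (k : nat) (T : finType) (c : pred T) (d : T -> nat)
    (e : T -> T -> nat) :
  (1 < k)%N -> #|c| = k -> (forall x, c x -> d x <= k.+1)%N ->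
  (\sum_(x | c x) d x = k ^ 2)%N ->
  (forall x y, c x -> c y -> d x = k.+1 -> e x y = d y) ->
  (forall x y, c x -> c y -> x != y ->
     e x y ^ 2 + d x + d y = d x * d y + 1)%N ->
  (forall x, c x -> d x = k) /\
  (forall x y, c x -> c y -> x != y -> e x y = k.-1).
Proof.
move=> k1 cardc dmax dsum efull minors.
have c1 x : c x -> #|[predD1 c & x]| = k.-1.
  by move=> cx; have := cardD1 x c; rewrite cardc [x \in c]cx => ->.
have small x : c x -> d x != k.+1.
  move=> cx; apply/eqP => dx.
  have two y : c y -> y != x -> d y = 2%N /\ k = 4%N.
    move=> cy nyx; have := minors x y cx cy; rewrite eq_sym => /(_ nyx).
    rewrite efull // dx => eq1.
    (* With full degree at [x] the codegree is [d y], and the minor becomes quadratic in [d y];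
       setting [k = d y + f] turns it into [d y + f = d y * f]. *)
    have eq2 : (d y * d y + k = k * d y)%N by nia.
    have le : (d y <= k)%N by nia.
    have [f ef] : exists f, k = (d y + f)%N by exists (k - d y)%N; lia.
    rewrite ef in eq2 *.
    have eq3 : (d y + f = d y * f)%N by nia.
    have pos : (0 < d y + f)%N by rewrite -ef ltnW.
    by have [-> ->] := add_eq_mul eq3 pos.
  have /card_gt0P[y] : (0 < #|[predD1 c & x]|)%N by rewrite c1 //; lia.
  rewrite !inE => /andP[yx cy]; have [_ k4] := two y cy yx.
  (* The degrees would sum to 5 + 3 * 2 = 11 rather than 4 ^ 2 = 16. *)
  move: dsum; rewrite (bigD1 x) //= dx.
  rewrite (eq_bigr (fun=> 2%N)); last by move=> z /andP[cz nz]; have [] := two z cz nz.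
  rewrite sum_nat_const (_ : #|_| = 3); first by rewrite k4.
  rewrite -[RHS]/(4.-1) -k4 -(c1 x cx); apply: eq_card => z.
  by rewrite !inE andbC.
have dle x : c x -> (d x <= k)%N.
  by move=> cx; have := dmax x cx; rewrite leq_eqVlt (negPf (small x cx)).
(* There are [k] degrees, each at most [k], with sum [k ^ 2]. *)
have dk x : c x -> d x = k.
  move=> cx; apply/eqP; rewrite eqn_leq dle //=.
  move: dsum; rewrite (bigD1 x) //= => es.
  have : (\sum_(i | c i && (i != x)) d i <= k.-1 * k)%N.
    rewrite -(c1 x cx) -sum_nat_const.
    rewrite (eq_bigl (fun i => i \in [predD1 c & x])); last first.
      by move=> i; rewrite !inE andbC.
    by apply: leq_sum => i; rewrite !inE => /andP[_ ci]; apply: dle.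
  by move: es; nia.
(* The minor is now [e x y ^ 2] = (k-1)^2. *)
split=> // x y cx cy nxy; have := minors x y cx cy nxy; rewrite !dk //.
by case: (k) k1 => // n _; nia.
Qed.

(** * Graphs cospectral with [H_graph k] *)

Lemma cospectral_mxsim (G H : sgraph) :
  perm_eq (spectrum G) (spectrum H) -> mxsim (adjmx G) (adjmx H).
Proof.
move=> e; apply: symmetric_char_poly_sim; rewrite ?tr_adjmx ?adjmx_real //.
by rewrite !spectrumP; apply: perm_big.
Qed.

Section Cospectral.
Variables (k : nat) (G : sgraph).
Hypotheses (k_gt1 : (1 < k)%N) (simGH : mxsim (adjmx G) (adjmx (H_graph k))).
Local Notation A := (adjmx G).

Let k_gt0 : (0 < k)%N := ltnW k_gt1.

Lemma cospectral_order : #|G| = k.*2.+1.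
Proof.
have [P [Q [PQ QP _]]] := simGH.
have /eqP : (\rank (1%:M : 'M[algC]_#|G|) = \rank (1%:M : 'M[algC]_#|H_graph k|)).
  by apply: mxsim_rank; exists P, Q; rewrite mulmx1.
by rewrite !mxrank1 card_H => /eqP.
Qed.

Lemma cospectral_rank_proj c : proper2 c -> \rank (proj_mx_of c * A)%R = k.
Proof.
move=> pc; apply: double_inj; rewrite -(H_rank k_gt0) -(mxsim_rank simGH).
by rewrite (odd_mx_rank _ _ (proper2_odd_mx pc)) ?proj_mx_idem ?tr_proj_mx.
Qed.

(** Either colour class has at least rank(DA) = k vertices, and together they have 2k+1, so one has
    exactly [k]. *)
Lemma cospectral_part : exists2 c : pred G, proper2 c & #|c| = k.
Proof.
have [c pc] : exists c : pred G, proper2 c.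
  apply: odd_trace0_proper2 => e oe.
  by rewrite (mxsim_trace _ simGH) H_odd_trace.
have pc' : proper2 (predC c) by move=> x y /pc /=; case: (c x); case: (c y).
have le (d : pred G) : proper2 d -> (k <= #|d|)%N.
  by move=> pd; rewrite -(cospectral_rank_proj pd) -rank_proj_mx mxrankM_maxl.
have e : (#|c| + #|(predC c : pred G)| = k.*2.+1)%N.
  by rewrite -cospectral_order; exact: cardC.
have := le _ pc; have := le _ pc' => h1 h2.
have [|ne] := eqVneq #|c| k; first by exists c.
by exists (predC c) => //; lia.
Qed.

(** This is codeg^2 = (d_x - 1)(d_y - 1), expanded to avoid truncated subtraction: the 2 x 2 minor
    of [D * (A * A - 1)] on [x] and [y]. *)
Lemma cospectral_minor (c : pred G) x y : proper2 c -> #|c| = k -> c x -> c y -> x != y ->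
  (#|nbrs x :&: nbrs y| ^ 2 + #|nbrs x| + #|nbrs y| =
   #|nbrs x| * #|nbrs y| + 1)%N.
Proof.
move=> pc ck cx cy nxy.
have : (\rank (proj_mx_of c * (A * A - 1))%R <= 1)%N.
  apply: odd_mx_rank_square; rewrite ?proj_mx_idem ?tr_proj_mx //.
  - exact: proper2_odd_mx.
  - by rewrite cospectral_rank_proj // rank_proj_mx.
  by rewrite (mxsim_rank (mxsim_cubic simGH)) H_rank_cubic.
have entry (a b : G) : c a -> (proj_mx_of c * (A * A - 1)) (enum_rank a) (enum_rank b) =
    #|nbrs a :&: nbrs b|%:R - (a == b)%:R.
  move=> ca; rewrite proj_mx_mulE enum_rankK ca mul1r [LHS]mxE.
  by rewrite adjmx_squareE !enum_rankK !mxE (inj_eq enum_rank_inj).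
move=> /(mxrank1_minor (enum_rank x) (enum_rank x) (enum_rank y) (enum_rank y)).
rewrite !entry // !setIid !eqxx (eq_sym y) (negPf nxy) !subr0 (setIC (nbrs y)).
move=> e; apply/eqP; rewrite -(eqr_nat algC) !natrD natrX natrM expr2 -e.
by apply/eqP; rewrite /=; ring.
Qed.

(** The diagonal of [A * A] carries the degrees, and each class contributes half of its trace. *)
Lemma cospectral_sum_degrees (c : pred G) : proper2 c ->
  (\sum_(x | c x) #|nbrs x| = k ^ 2)%N.
Proof.
move=> pc; apply/double_inj/eqP; rewrite -(eqr_nat algC) -(H_trace_square k_gt0).
rewrite -expr2 -(mxsim_trace _ simGH) expr2.
rewrite (odd_mx_trace_square (proper2_odd_mx pc)) -muln2 natrM mulr_natr natr_sum.
apply/eqP; congr (_ *+ 2); rewrite -(sum_enum_val (fun x => #|nbrs x|%:R)).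
rewrite big_mkcond; apply: eq_bigr => i _.
rewrite proj_mx_mulE adjmx_squareE setIid.
by case: (c _); rewrite ?mul1r ?mul0r.
Qed.

Lemma mxsim_H_graph_isomorphic : isomorphic G (H_graph k).
Proof.
have [c pc ck] := cospectral_part.
have card_other : #|[set z | ~~ c z]| = k.+1.
  have := cardC c; rewrite ck cospectral_order cardsE => e.
  by apply/eqP; rewrite -(eqn_add2l k) e -addnn addnS.
have subW x : c x -> nbrs x \subset [set z | ~~ c z].
  by move=> cx; apply/subsetP=> z; rewrite !inE => /pc; rewrite cx; case: (c z).
have [||||deg codeg] := @degrees_of_minors k G c (fun x => #|nbrs x|)
  (fun x y => #|nbrs x :&: nbrs y|) k_gt1 ck.
- by move=> x /subW /subset_leq_card; rewrite card_other.
- exact: cospectral_sum_degrees.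
(* A vertex of degree [k.+1] is adjacent to the whole other class, so it shares all neighbours of
   [y]. *)
- move=> x y cx cy dx; congr #|pred_of_set _|; apply/setIidPr.
  suff -> : nbrs x = [set z | ~~ c z] by exact: subW.
  by apply/eqP; rewrite eqEcard subW // card_other; exact: eq_leq (esym dx).
- by move=> x y; apply: cospectral_minor.
by apply: (isomorphic_H_graph cospectral_order pc).
Qed.
End Cospectral.

Local Close Scope ring_scope.

Theorem corollary11 (k : nat) (hk : 2 <= k) : DS (H_graph k).
Proof. by move=> G /cospectral_mxsim; apply: mxsim_H_graph_isomorphic. Qed.
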